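(* Let $b\ge4$ be an even base and $B=b-1$. Every Kaprekar index $\mathbf k=(k_0,k_1,\ldots,k_B)$ with $k_1=k_2=\cdots=k_{B-1}\ge1$ and $1\le k_0\le k_B<k_0+k_1$ represents a fixed point of the Kaprekar transformation, i.e. $\mathbf k'=\mathbf k$.
   Context: Integers with digit-count $n$ in base $b$ are identified with strings of exactly $n$ base-$b$ digits (leading zeros allowed). If $a_0\le a_1\le\cdots\le a_{n-1}$ are the base-$b$ digits of $x$ in ascending order, the Kaprekar transformation is $T_{b,n}(x)=\sum_{j=0}^{n-1}a_jb^j-\sum_{j=0}^{n-1}a_jb^{n-1-j}$, again regarded as an $n$-digit string. The Kaprekar index of $x$ is the $b$-tuple $\mathbf k=(k_0,\ldots,k_{B})$, where $k_i$ is the number of occurrences of the digit $i$ among the $n$ digits (so $n=\sum_i k_i$). $T_{b,n}(x)$ depends only on $\mathbf k$; the Kaprekar index of $T_{b,n}(x)$ is denoted $\mathbf k'$. The index $\mathbf k$ represents a fixed point when $\mathbf k'=\mathbf k$; equivalently, for any $x$ with index $\mathbf k$, the integer $T_{b,n}(x)$ has index $\mathbf k$ and is fixed by $T_{b,n}$. *)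

(* Defs.v *)
From mathcomp Require Import all_boot.
From mathcomp Require Import zify.

Set Implicit Arguments.
Unset Strict Implicit.
Unset Printing Implicit Defensive.

(* The last n base-b digits of x, least significant first; this is the n-digit
   string identified with x when x < b ^ n. *)
Definition digits (b n x : nat) : seq nat :=
  [seq x %/ b ^ i %% b | i <- iota 0 n].

Definition asc_digits (b n x : nat) : seq nat := sort leq (digits b n x).

(* The subtraction on nat is never truncated: see kaprekar_le. *)
Definition kaprekar (b n x : nat) : nat :=
  \sum_(j < n) nth 0 (asc_digits b n x) j * b ^ j
    - \sum_(j < n) nth 0 (asc_digits b n x) j * b ^ (n - 1 - j).

Definition kaprekar_index (b n x : nat) : b.-tuple nat :=
  [tuple count_mem (i : nat) (digits b n x) | i < b].

(* The length n of the strings is determined by the index k.  The quantifier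
   over x ranges over a nonempty set (exists_kaprekar_index), and kaprekar b n x
   is the same for all these x (kaprekar_index_inj). *)
Definition represents_fixed_point (b : nat) (k : b.-tuple nat) : Prop :=
  forall x : nat, x < b ^ sumn k -> kaprekar_index b (sumn k) x = k ->
    kaprekar_index b (sumn k) (kaprekar b (sumn k) x) = k.

Lemma size_digits b n x : size (digits b n x) = n.
Proof. by rewrite size_map size_iota. Qed.

Lemma kaprekar_le b n x : 0 < b ->
  \sum_(j < n) nth 0 (asc_digits b n x) j * b ^ (n - 1 - j)
    <= \sum_(j < n) nth 0 (asc_digits b n x) j * b ^ j.
Proof.
move=> b_gt0; set a := nth 0 _.
have a_mono i j : i <= j -> j < n -> a i <= a j.
  move=> le_ij lt_jn; apply: (sorted_leq_nth leq_trans leqnn) => //.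
  - by apply: sort_sorted; apply: leq_total.
  - by rewrite inE size_sort size_digits (leq_ltn_trans le_ij).
  - by rewrite inE size_sort size_digits.
have rev_in (F : nat -> nat) : \sum_(j < n) F j = \sum_(j < n) F (n - 1 - j).
  rewrite (reindex_inj rev_ord_inj) /=; apply: eq_bigr => j _.
  by rewrite -subnDA add1n.
rewrite -leq_double -!addnn {2}(rev_in (fun j => a j * b ^ (n - 1 - j))).
rewrite {2}(rev_in (fun j => a j * b ^ j)) -!big_split /=.
apply: leq_sum => j _; have lt_jn := ltn_ord j.
have -> : n - 1 - (n - 1 - j) = j by lia.
set i := n - 1 - j.
have lt_in : i < n by lia.
have rearr p q u v : p <= q -> u <= v -> p * v + q * u <= p * u + q * v.
  by move=> *; nia.
case: (leqP j i) => [le_ji | /ltnW le_ij].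
  by apply: rearr; [apply: a_mono | rewrite leq_pexp2l].
by rewrite addnC [leqRHS]addnC; apply: rearr; [apply: a_mono | rewrite leq_pexp2l].
Qed.

Lemma digits_lt b n x d : 0 < b -> d \in digits b n x -> d < b.
Proof. by move=> b_gt0 /mapP[i _ ->]; rewrite ltn_pmod. Qed.

Lemma kaprekar_index_inj b n x y : 0 < b ->
  kaprekar_index b n x = kaprekar_index b n y ->
  kaprekar b n x = kaprekar b n y.
Proof.
move=> b_gt0 eq_xy; rewrite /kaprekar.
suff -> : asc_digits b n x = asc_digits b n y by [].
apply/(perm_sortP leq_total leq_trans anti_leq)/allP => d.
rewrite mem_cat => xy_d /=.
have lt_db : d < b by case/orP: xy_d; apply: digits_lt.
have := congr1 (fun k => tnth k (Ordinal lt_db)) eq_xy.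
by rewrite !tnth_mktuple /= => ->.
Qed.

Lemma digitsS b n x : digits b n.+1 x = x %% b :: digits b n (x %/ b).
Proof.
rewrite /digits /= expn0 divn1; congr cons.
rewrite (iotaDl 1 0) -map_comp; apply: eq_map => i /=.
by rewrite add1n expnS divnMA.
Qed.

Lemma digits_onto b (s : seq nat) : all (ltn^~ b) s ->
  exists2 x, x < b ^ size s & digits b (size s) x = s.
Proof.
elim: s => [|d s IHs] /=; first by exists 0.
case/andP=> lt_db /IHs[x lt_x def_s]; have b_gt0 := leq_ltn_trans (leq0n d) lt_db.
exists (x * b + d).
  by rewrite expnSr; apply: leq_trans (leq_mul lt_x (leqnn b)); rewrite mulSn addnC ltn_add2r.
by rewrite digitsS modnMDl modn_small // divnMDl // divn_small // addn0 def_s.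
Qed.

Lemma exists_kaprekar_index b (k : b.-tuple nat) :
  exists2 x, x < b ^ sumn k & kaprekar_index b (sumn k) x = k.
Proof.
pose s := flatten [seq nseq (tnth k i) (i : nat) | i <- enum 'I_b].
have size_s : size s = sumn k.
  rewrite size_flatten /shape -map_comp; congr sumn.
  rewrite (eq_map (g := tnth k)) => [|i]; last by rewrite /= size_nseq.
  exact: map_tnth_enum.
have lt_s : all (ltn^~ b) s.
  apply/allP=> d /flatten_mapP[i _ /nseqP[-> _]]; exact: ltn_ord.
have [x] := digits_onto lt_s; rewrite size_s => lt_x def_s.
exists x => //; apply: eq_from_tnth => i; rewrite tnth_mktuple def_s.
rewrite count_flatten sumnE !big_map (bigD1 i) //=.
rewrite count_nseq /= eqxx mul1n big1 ?addn0 // => j neq_ji.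
by rewrite count_nseq /= (inj_eq val_inj) (negPf neq_ji).
Qed.

(* Main.v *)
Require Import Defs.
From mathcomp Require Import all_boot.
From mathcomp Require Import zify ring.

Set Implicit Arguments.
Unset Strict Implicit.
Unset Printing Implicit Defensive.

(* Write k = (p, m, ..., m, p + s) with s < m, put u = m - s and b = 2h.
   Subtracting the descending string from the ascending one digit by digit,
   starting from the units, gives the differences -(b - 1) (p times), then
   2i - b (s times) and 2i - (b - 1) (u times) for i = 1, ..., b - 2, then
   b - 2 (s times) and b - 1 (p times).  A borrow arises in the units place and
   persists until the first positive difference, which is 1, reached at i = h.
   Below that place the digits produced are 1, then 0 (p - 1 times), 2i - 1
   (s times) and 2i (u times) for i < h, and b - 1 (s times); from there on they
   are 0, then 1 (u - 1 times), 2i - b (s times) and 2i - (b - 1) (u times) for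
   i > h, b - 2 (s times) and b - 1 (p times).  Each value occurs as often as k
   prescribes. *)

Fixpoint of_digits (b : nat) (s : seq nat) : nat :=
  if s is d :: s' then d + b * of_digits b s' else 0.

Lemma of_digits_cat b s t :
  of_digits b (s ++ t) = of_digits b s + b ^ size s * of_digits b t.
Proof.
elim: s => [|d s IHs] /=; first by rewrite mul1n.
by rewrite IHs expnS; ring.
Qed.

Lemma of_digitsE b s : of_digits b s = \sum_(j < size s) nth 0 s j * b ^ j.
Proof.
elim: s => [|d s IHs] /=; first by rewrite big_ord0.
rewrite big_ord_recl /= muln1 IHs big_distrr /=; congr (_ + _).
by apply: eq_bigr => j _; rewrite expnS mulnCA.
Qed.

Lemma of_digits_rev b s :
  of_digits b (rev s) = \sum_(j < size s) nth 0 s j * b ^ (size s - 1 - j).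
Proof.
rewrite of_digitsE size_rev (reindex_inj rev_ord_inj) /=.
apply: eq_bigr => j _; rewrite nth_rev; last by have := ltn_ord j; lia.
by congr (nth _ _ _ * _ ^ _); have := ltn_ord j; lia.
Qed.

Lemma digits_of_digits b s : all (ltn^~ b) s ->
  digits b (size s) (of_digits b s) = s.
Proof.
elim: s => [|d s IHs] //= /andP[lt_db /IHs def_s].
rewrite digitsS mulnC addnC modnMDl modn_small // divnMDl; last by lia.
by rewrite divn_small // addn0 def_s.
Qed.

Lemma kaprekarE b n x :
  kaprekar b n x =
    of_digits b (asc_digits b n x) - of_digits b (rev (asc_digits b n x)).
Proof.
by rewrite of_digits_rev of_digitsE /kaprekar size_sort size_digits.
Qed.

Lemma sorted_flatten_nseq (c : nat -> nat) r N :
  sorted leq (flatten [seq nseq (c i) i | i <- iota r N]).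
Proof.
rewrite sorted_pairwise; last exact: leq_trans.
elim: N r => [|N IHN] r //=; rewrite pairwise_cat IHN andbT; apply/andP; split.
  apply/allrelP => i j /nseqP[-> _] /flatten_mapP[l].
  by rewrite mem_iota => /andP[/ltnW le_rl _] /nseqP[-> _].
by elim: (c r) => //= l ->; rewrite andbT; apply/allP => j /nseqP[->].
Qed.

Lemma count_flatten_nseq (c : nat -> nat) v r N :
  count_mem v (flatten [seq nseq (c i) i | i <- iota r N]) =
    if r <= v < r + N then c v else 0.
Proof.
elim: N r => [|N IHN] r /=; first by case: ifP => //; lia.
rewrite count_cat IHN count_nseq /=.
by have [->|] := eqVneq r v; do ?case: ifP => //; lia.
Qed.

(** Both strings are sorted, and they agree up to permutation because each value has the same count
    in both. *)
Lemma asc_digits_index b n x (k : b.-tuple nat) : 0 < b ->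
  kaprekar_index b n x = k ->
  asc_digits b n x = flatten [seq nseq (nth 0 k i) i | i <- iota 0 b].
Proof.
move=> b_gt0 def_k; apply: (sorted_eq leq_trans anti_leq).
- by apply: sort_sorted; apply: leq_total.
- exact: sorted_flatten_nseq.
rewrite perm_sort; apply/allP => v _; apply/eqP.
rewrite count_flatten_nseq add0n /=; case: ltnP => [lt_vb | le_bv].
  by rewrite -(tnth_nth 0 k (Ordinal lt_vb)) -def_k tnth_mktuple.
by apply/count_memPn/negP => /(digits_lt b_gt0); rewrite ltnNge le_bv.
Qed.

(* c is the borrow into the units place, c' the borrow out of the top place. *)
Definition borrow_sub (b c : nat) (a r t : seq nat) (c' : nat) : Prop :=
  [/\ size a = size t, size r = size t &
      of_digits b a + b ^ size t * c' = of_digits b r + of_digits b t + c].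

(** The intermediate borrow [c2], with weight [b ^ size t], is on opposite sides of the two
    equations and cancels. *)
Lemma borrow_sub_cat b c1 c2 c3 a a' r r' t t' :
  borrow_sub b c1 a r t c2 -> borrow_sub b c2 a' r' t' c3 ->
  borrow_sub b c1 (a ++ a') (r ++ r') (t ++ t') c3.
Proof.
move=> [sa sr e] [sa' sr' e']; split; rewrite ?size_cat ?sa ?sr ?sa' ?sr' //.
rewrite !of_digits_cat sa sr expnD -mulnA -addnA -mulnDr e' !mulnDr.
by move: e; set z := b ^ size t * c2; lia.
Qed.

Lemma borrow_sub_nseq b c a r t l : a + b * c = r + t + c ->
  borrow_sub b c (nseq l a) (nseq l r) (nseq l t) c.
Proof.
move=> e; elim: l => [|l IHl]; first by split=> //=; rewrite mul1n.
apply: (@borrow_sub_cat b c c c [:: a] _ [:: r] _ [:: t]) => //.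
by split=> //=; rewrite !muln0 !addn0.
Qed.

Lemma borrow_sub_digit b c c' a r t : a + b * c' = r + t + c ->
  borrow_sub b c [:: a] [:: r] [:: t] c'.
Proof. by move=> e; split=> //=; rewrite !muln0 !addn0. Qed.

(** The run of each ascending digit is split in two because its first [s] columns and its last [u]
    columns face different descending digits. *)
Definition blocks (s u : nat) (f g : nat -> nat) (l : seq nat) : seq nat :=
  flatten [seq nseq s (f i) ++ nseq u (g i) | i <- l].

Lemma blocks_cat s u f g l1 l2 :
  blocks s u f g (l1 ++ l2) = blocks s u f g l1 ++ blocks s u f g l2.
Proof. by rewrite /blocks map_cat flatten_cat. Qed.

Lemma blocks_cons s u f g i l :
  blocks s u f g (i :: l) = nseq s (f i) ++ nseq u (g i) ++ blocks s u f g l.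
Proof. by rewrite /blocks /= catA. Qed.

Lemma borrow_sub_blocks b c s u fa ga fr gr ft gt l :
  {in l, forall i, fa i + b * c = fr i + ft i + c} ->
  {in l, forall i, ga i + b * c = gr i + gt i + c} ->
  borrow_sub b c (blocks s u fa ga l) (blocks s u fr gr l)
    (blocks s u ft gt l) c.
Proof.
elim: l => [|i l IHl] ef eg; first by split=> //=; rewrite mul1n.
rewrite !blocks_cons; apply: borrow_sub_cat.
  by apply/borrow_sub_nseq/ef/mem_head.
apply: borrow_sub_cat; first by apply/borrow_sub_nseq/eg/mem_head.
by apply: IHl => j l_j; [apply: ef | apply: eg]; rewrite inE l_j orbT.
Qed.

(* Reversal regroups the blocks: the run of each value i, of length s + u, is
   cut at distance s from its start, hence at distance u after reversal. *)
Lemma rev_blocks s u N :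
  rev (blocks s u id id (iota 1 N) ++ nseq s N.+1) =
    blocks s u (fun i => N.+2 - i) (fun i => N.+1 - i) (iota 1 N) ++ nseq s 1.
Proof.
elim: N => [|N IHN]; first by rewrite /= rev_nseq.
(* Reversal exchanges the ends, so the last value is split off on the left and the first on the
   right; the index shift then matches the induction hypothesis. *)
have {1}-> : iota 1 N.+1 = iota 1 N ++ [:: N.+1].
  by rewrite -[in LHS](addn1 N) iotaD add1n.
have -> : iota 1 N.+1 = 1 :: [seq i.+1 | i <- iota 1 N].
  by rewrite /= (iotaDl 1 1).
rewrite blocks_cat !blocks_cons cats0 catA -catA rev_cat rev_cat !rev_nseq.
rewrite IHN -!catA subn1 /= subn1 /=; do 2 congr (_ ++ _).
by rewrite /blocks -map_comp.
Qed.

(** The entries run through consecutive values, those of the parity of [y] coming [s] times and the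
    others [u] times; [y <= 2 * r] prevents truncation. *)
Lemma count_blocks s u v y r N : y <= 2 * r ->
  count_mem v (blocks s u (fun i => 2 * i - y) (fun i => (2 * i).+1 - y)
                (iota r N)) =
    if 2 * r - y <= v < 2 * (r + N) - y then (if odd (v + y) then u else s)
    else 0.
Proof.
elim: N r => [|N IHN] r le_yr /=; first by case: ifP => //; lia.
rewrite blocks_cons !count_cat !count_nseq /= IHN; last by lia.
by do ?case: eqP; do ?case: ifP; lia.
Qed.

(** The top run, of length [p + s], is cut so that reversal exchanges two outer runs of length [p]
    and [rev_blocks] applies to the middle. *)
Lemma asc_blocks (b p m s : nat) (k : b.-tuple nat) : 2 <= b -> s <= m ->
  (forall i, 1 <= i <= b - 2 -> nth 0 k i = m) ->
  nth 0 k 0 = p -> nth 0 k (b - 1) = p + s ->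
  flatten [seq nseq (nth 0 k i) i | i <- iota 0 b] =
    nseq p 0 ++ (blocks s (m - s) id id (iota 1 (b - 2)) ++ nseq s (b - 1))
      ++ nseq p (b - 1).
Proof.
move=> le2b le_sm hmid hk0 hkB.
have -> : iota 0 b = 0 :: iota 1 (b - 2) ++ [:: b - 1].
  have e : b = 1 + (b - 2 + 1) by lia.
  rewrite {1}e iotaD iotaD /=; congr (_ :: _ ++ [:: _]); lia.
rewrite /= map_cat flatten_cat /= hk0 hkB cats0 (addnC p) nseqD -!catA.
congr (_ ++ _ ++ _); congr flatten; apply/eq_in_map => i.
rewrite mem_iota => i_mid; rewrite hmid; last by lia.
by rewrite -nseqD subnKC.
Qed.

Definition fixed_string (h p s u : nat) : seq nat :=
  ([:: 1] ++ nseq (p - 1) 0) ++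
  ((blocks s u (fun i => 2 * i - 1) (fun i => (2 * i).+1 - 1) (iota 1 (h - 1)) ++
    nseq s (2 * h - 1) ++ ([:: 0] ++ nseq (u - 1) 1) ++
    blocks s u (fun i => 2 * i - 2 * h) (fun i => (2 * i).+1 - 2 * h)
      (iota h.+1 (h - 2))) ++
   nseq s (2 * h - 2)) ++ nseq p (2 * h - 1).

(** The lower blocks give odd values [s] times and even ones [u] times, the upper blocks the
    opposite, for a total of [s + u]. The separate runs complete the counts of 0, 1, [2 * h - 2] and
    [2 * h - 1]. *)
Lemma count_fixed_string h p s u v : 2 <= h -> 0 < p -> 0 < u ->
  count_mem v (fixed_string h p s u) =
    if v == 0 then p else if v == 2 * h - 1 then p + s
    else if v < 2 * h then s + u else 0.
Proof.
move=> le2h p_gt0 u_gt0.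
rewrite /fixed_string !count_cat !count_blocks ?count_nseq /=; [|lia..].
have decide_v : v = 0 \/ v = 1 \/ v = 2 * h - 2 \/ v = 2 * h - 1 \/
  2 * h <= v \/ 1 < v < 2 * h - 2 by lia.
rewrite (oddD v 1) (oddD v (2 * h)) oddM addbT addbF.
move: decide_v => [|[|[|[|[|]]]]] decide_v;
  do !match goal with
  | |- context [?x == ?y] =>
    first [have -> : (x == y) = true by lia | have -> : (x == y) = false by lia]
  | |- context [if ?c then _ else _] =>
    first [have -> : c = true by lia | have -> : c = false by lia]
  end; by case: (odd v) decide_v => /=; lia.
Qed.

Lemma borrow_sub_fixed_string h p s u : 2 <= h -> 0 < p -> 0 < u ->
  let b := 2 * h in
  let a := nseq p 0 ++ (blocks s u id id (iota 1 (b - 2)) ++ nseq s (b - 1))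
             ++ nseq p (b - 1) in
  borrow_sub b 0 a (rev a) (fixed_string h p s u) 0.
Proof.
move=> le2h p_gt0 u_gt0 b a.
have def_b : b - 1 = (b - 2).+1 by lia.
have -> : rev a = nseq p (b - 1) ++
    (blocks s u (fun i => b - i) (fun i => b - 1 - i) (iota 1 (b - 2)) ++
     nseq s 1) ++ nseq p 0.
  rewrite /a def_b rev_cat [in LHS]rev_cat rev_blocks !rev_nseq -catA.
  by have -> : (b - 2).+2 = b by lia.
have def_p l (d : nat) : 0 < l -> nseq l d = [:: d] ++ nseq (l - 1) d.
  by case: l => // l _; rewrite subn1.
rewrite /a /fixed_string.
have -> : iota 1 (b - 2) = iota 1 (h - 1) ++ h :: iota h.+1 (h - 2).
  have -> : b - 2 = (h - 1) + (h - 2).+1 by lia.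
  by rewrite iotaD subnKC //; lia.
rewrite !blocks_cat !blocks_cons.
apply: (@borrow_sub_cat _ _ 1).
  rewrite !(def_p p) //; apply: (@borrow_sub_cat _ _ 1).
    by apply: borrow_sub_digit; lia.
  by apply: borrow_sub_nseq; lia.
apply: (@borrow_sub_cat _ _ 0); last by apply: borrow_sub_nseq; lia.
apply: (@borrow_sub_cat _ _ 0); last by apply: borrow_sub_nseq; lia.
apply: (@borrow_sub_cat _ _ 1).
  by apply: borrow_sub_blocks => i; rewrite mem_iota; lia.
apply: (@borrow_sub_cat _ _ 1); first by apply: borrow_sub_nseq; lia.
(* Here [h] faces [b - 1 - h = h - 1]: the first of these [u] columns absorbs the borrow and leaves
   the digit 0. *)
apply: (@borrow_sub_cat _ _ 0).
  rewrite !(def_p u) //; apply: (@borrow_sub_cat _ _ 0).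
    by apply: borrow_sub_digit; lia.
  by apply: borrow_sub_nseq; lia.
by apply: borrow_sub_blocks => i; rewrite mem_iota; lia.
Qed.

Theorem theorem6 (b : nat) (hb : 4 <= b) (b_even : ~~ odd b)
    (k : b.-tuple nat)
    (hmid : forall i : nat, 1 <= i <= b - 2 -> nth 0 k i = nth 0 k 1)
    (hk1 : 1 <= nth 0 k 1)
    (hk0 : 1 <= nth 0 k 0)
    (hk0B : nth 0 k 0 <= nth 0 k (b - 1))
    (hkB : nth 0 k (b - 1) < nth 0 k 0 + nth 0 k 1) :
  represents_fixed_point k.
Proof.
move=> x _ def_k; set n := sumn k.
set m := nth 0 k 1 in hmid hk1 hkB; set p := nth 0 k 0 in hk0 hk0B hkB.
pose s := nth 0 k (b - 1) - p; pose u := m - s; pose h := b./2.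
have def_b : b = 2 * h by lia.
have le2h : 2 <= h by lia.
have u_gt0 : 0 < u by lia.
have def_a := asc_digits_index (ltnW (ltnW (ltnW hb))) def_k.
have le_sm : s <= m by lia.
have eq_kB : nth 0 k (b - 1) = p + s by lia.
rewrite (asc_blocks (ltnW (ltnW hb)) le_sm hmid (erefl p) eq_kB) in def_a.
have := borrow_sub_fixed_string s le2h hk0 u_gt0.
rewrite /= -def_b -def_a; set t := fixed_string _ _ _ _.
have count_t v : count_mem v t = nth 0 k v.
  rewrite count_fixed_string // -def_b.
  have [-> //|v_neq0] := eqVneq v 0; have [-> //|v_neqB] := eqVneq v (b - 1).
  case: ltnP => [lt_vb | le_bv]; last by rewrite nth_default ?size_tuple.
  by rewrite hmid; lia.
(* A value [v >= b] lies beyond the end of [k], so its count in [t] is the default 0. *)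
have lt_t : all (ltn^~ b) t.
  apply/allP => v; rewrite -has_pred1 has_count count_t.
  by case: (ltnP v b) => // le_bv; rewrite nth_default ?size_tuple.
(* With no borrow at either end, the ascending number is exactly the descending one plus
   [of_digits b t]. *)
rewrite /borrow_sub muln0 !addn0 kaprekarE => -[size_t _ ->]; rewrite addKn.
have {}size_t : size t = n by rewrite -size_t size_sort size_digits.
apply: eq_from_tnth => i; rewrite tnth_mktuple -size_t digits_of_digits //.
by rewrite count_t -tnth_nth.
Qed.
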